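(* Let $E$ be a finite ground set with $|E|=n$, let $k\ge 1$ be an integer, let $(E,\mathcal{F})$ be a matroid of rank $r$, and let $f:(k+1)^E\to\mathbb{R}$ be a $k$-submodular function with $f(\mathbf{0})=0$. Let $\epsilon\in(0,1)$, and let $OPT=\max\{f(\mathbf{p}) : \mathbf{p}\in(k+1)^E,\ \mathrm{supp}(\mathbf{p})\in\mathcal{F}\}$. Let $\mathbf{p}$ be the output of the Decreasing-Threshold procedure (described in the context) run on $f$, $(E,\mathcal{F})$ and $\epsilon$. Then $\mathrm{supp}(\mathbf{p})\in\mathcal{F}$, and: (i) if $f$ is monotone, $f(\mathbf{p})\ge(\frac{1}{2}-\epsilon)\,OPT$; (ii) if $f$ is non-monotone, $f(\mathbf{p})\ge(\frac{1}{3}-\epsilon)\,OPT$. In both cases the procedure makes $O\!\left(\frac{n(k\cdot EO+IO)}{\epsilon}\log\frac{r}{\epsilon}\right)$ oracle work, where $EO$ is the cost of one evaluation of $f$ and $IO$ is the cost of one query to the independence oracle of the matroid.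
   Context: $(k+1)^E$ denotes the set of $k$-tuples $\mathbf{p}=(P_1,\dots,P_k)$ of pairwise disjoint subsets of $E$; equivalently, $\mathbf{p}\in\{0,1,\dots,k\}^E$, where $\mathbf{p}(e)=i$ if $e\in P_i$ and $\mathbf{p}(e)=0$ if $e$ lies in no $P_i$. Write $\mathrm{supp}(\mathbf{p})=\bigcup_i P_i$ and $\mathbf{0}=(\emptyset,\dots,\emptyset)$. For $\mathbf{p},\mathbf{q}$, define $\mathbf{p}\sqcap\mathbf{q}=(P_1\cap Q_1,\dots,P_k\cap Q_k)$ and $\mathbf{p}\sqcup\mathbf{q}$ with $i$-th component $(P_i\cup Q_i)\setminus\bigcup_{j\ne i}(P_j\cup Q_j)$. $f$ is $k$-submodular if $f(\mathbf{p})+f(\mathbf{q})\ge f(\mathbf{p}\sqcup\mathbf{q})+f(\mathbf{p}\sqcap\mathbf{q})$ for all $\mathbf{p},\mathbf{q}$. Write $\mathbf{p}\preceq\mathbf{q}$ if $P_i\subseteq Q_i$ for all $i$; $f$ is monotone if $f(\mathbf{p})\le f(\mathbf{q})$ whenever $\mathbf{p}\preceq\mathbf{q}$. For $e\notin\mathrm{supp}(\mathbf{p})$ and $i\in[k]$, $\Delta_{e,i}f(\mathbf{p})=f(P_1,\dots,P_i\cup\{e\},\dots,P_k)-f(\mathbf{p})$. $i\mathbf{1}_e$ denotes the $k$-tuple with $e$ in the $i$-th set and all other sets empty. The rank $r$ of the matroid is the size of any basis (maximal independent set). Decreasing-Threshold procedure: set $\mathbf{p}\leftarrow\mathbf{0}$,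 $d=\max_{e\in E,i\in[k]}f(i\mathbf{1}_e)$, $w\leftarrow d$, $F(\mathbf{p})\leftarrow E$. While $w>\frac{(1-\epsilon)\epsilon}{2r}d$ and $F(\mathbf{p})\neq\emptyset$: for each $e\in F(\mathbf{p})$ in turn, let $i\in\arg\max_{i\in[k]}\Delta_{e,i}f(\mathbf{p})$; if $\Delta_{e,i}f(\mathbf{p})\ge w$, set $\mathbf{p}(e)\leftarrow i$ and recompute, using the independence oracle, $F(\mathbf{p})=\{e'\in E\setminus\mathrm{supp}(\mathbf{p}) : \mathrm{supp}(\mathbf{p})\cup\{e'\}\in\mathcal{F}\}$. After the for-loop, set $w\leftarrow(1-\epsilon)w$. When the while-loop ends, return $\mathbf{p}$.
   Formalization: The matroid is assumed to have no loops; (ii) is proved for k ≥ 2 (it fails for k = 1); the work bound is for r/ε ≥ x0 with x0 > 1 fixed (constant depends on x0); inside the for-loop, membership in F(p) is tested on demand with one query rather than recomputing F(p) after each insertion. *)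

(* Defs.v *)
From HB Require Import structures.
From mathcomp Require Import all_boot all_order all_algebra.
From mathcomp Require Import reals exp.

Set Implicit Arguments.
Unset Strict Implicit.
Unset Printing Implicit Defensive.

Import Order.TTheory GRing.Theory Num.Theory.
Local Open Scope ring_scope.

(* An element p of (k+1)^E: [p e = Some i] when e lies in the i-th set, and
   [p e = None] (the value 0) when e lies in none of them. The labels 1..k are
   represented by 'I_k. *)
Definition config (E : finType) (k : nat) := {ffun E -> option 'I_k}.

Definition part {E : finType} {k : nat} (p : config E k) (i : 'I_k) : {set E} :=
  [set e | p e == Some i]%SET.

Definition supp {E : finType} {k : nat} (p : config E k) : {set E} :=
  (\bigcup_i part p i)%SET.

Definition cfg0 {E : finType} {k : nat} : config E k := [ffun => None].

(* Only meaningful for pairwise disjoint families A. *)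
Definition of_parts {E : finType} {k : nat} (A : 'I_k -> {set E}) :
  config E k := [ffun e => [pick i | e \in A i]].

Definition kmeet {E : finType} {k : nat} (p q : config E k) : config E k :=
  of_parts (fun i => part p i :&: part q i)%SET.

Definition kjoin {E : finType} {k : nat} (p q : config E k) : config E k :=
  of_parts (fun i => (part p i :|: part q i) :\:
                     \bigcup_(j | j != i) (part p j :|: part q j))%SET.

Lemma part_of_parts (E : finType) (k : nat) (A : 'I_k -> {set E}) (i : 'I_k) :
  (forall i j e, e \in A i -> e \in A j -> i = j) ->
  part (of_parts A) i = A i.
Proof.
move=> dA; apply/setP => e; rewrite inE ffunE; case: pickP => [j ej|->//].
apply/eqP/idP => [[<-]//|ei]; by rewrite (dA _ _ _ ej ei).
Qed.

Lemma part_kmeet (E : finType) (k : nat) (p q : config E k) (i : 'I_k) :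
  part (kmeet p q) i = (part p i :&: part q i)%SET.
Proof.
apply: part_of_parts => {}i j e; rewrite !inE.
by move=> /andP[/eqP-> _] /andP[/eqP[->]].
Qed.

Lemma part_kjoin (E : finType) (k : nat) (p q : config E k) (i : 'I_k) :
  part (kjoin p q) i = ((part p i :|: part q i) :\:
                        \bigcup_(j | j != i) (part p j :|: part q j))%SET.
Proof.
rewrite /kjoin part_of_parts// => {}i j e.
rewrite !finset.in_setD => /andP[_ ei] /andP[ej _].
apply/eqP/negPn/negP => nij; move/negP: ej; apply.
by apply/bigcupP; exists i.
Qed.

Definition kpreceq {E : finType} {k : nat} (p q : config E k) : Prop :=
  forall i, part p i \subset part q i.

Definition ksubmodular {R : realType} {E : finType} {k : nat}
    (f : config E k -> R) : Prop :=
  forall p q, f (kjoin p q) + f (kmeet p q) <= f p + f q.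

Definition kmonotone {R : realType} {E : finType} {k : nat}
    (f : config E k -> R) : Prop :=
  forall p q, kpreceq p q -> f p <= f q.

Definition assign {E : finType} {k : nat} (p : config E k) (e : E) (i : 'I_k) :
  config E k := [ffun x => if x == e then Some i else p x].

Definition single {E : finType} {k : nat} (e : E) (i : 'I_k) : config E k :=
  assign cfg0 e i.

(* Delta_{e,i} f (p), used only for e \notin supp p. *)
Definition gain {R : realType} {E : finType} {k : nat} (f : config E k -> R)
    (p : config E k) (e : E) (i : 'I_k) : R :=
  f (assign p e i) - f p.

(* The maximum of g over P; 0 by convention when P is empty. *)
Definition maxval {R : realType} {T : finType} (P : pred T) (g : T -> R) : R :=
  if [pick x | P x] is Some x0 then g [arg max_(x > x0 | P x) g x]%O else 0.

Definition matroid {E : finType} (F : {set {set E}}) : Prop :=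
  [/\ set0 \in F,
      (forall A B : {set E}, B \in F -> A \subset B -> A \in F)
    & (forall A B : {set E}, A \in F -> B \in F -> (#|A| < #|B|)%N ->
         exists2 e, e \in B :\: A & (e |: A)%SET \in F)].

Definition matroid_basis {E : finType} (F : {set {set E}}) (B : {set E}) :
  bool := maxset (fun A : {set E} => A \in F) B.

(* Determines r, since a matroid has at least one basis. *)
Definition matroid_rank {E : finType} (F : {set {set E}}) (r : nat) : Prop :=
  forall B, matroid_basis F B -> #|B| = r.

Definition loopless {E : finType} (F : {set {set E}}) : Prop :=
  forall e : E, [set e]%SET \in F.

(* F(p). *)
Definition feasible {E : finType} {k : nat} (F : {set {set E}})
    (p : config E k) : {set E} :=
  [set e | (e \notin supp p) && ((e |: supp p) \in F)]%SET.

(* The procedure starts with E as the candidate set; that is F(0) exactly when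
   the matroid is loopless. *)
Lemma feasible_cfg0 (E : finType) (k : nat) (F : {set {set E}}) :
  loopless F <-> feasible F (@cfg0 E k) = [set: E]%SET.
Proof.
have s0 : supp (@cfg0 E k) = set0.
  by apply: big1 => i _; apply/setP => e; rewrite !inE ffunE.
split=> [lF|F0 e].
  by apply/setP => e; rewrite !inE s0 !inE setU0 lF.
have : e \in feasible F (@cfg0 E k) by rewrite F0 inE.
by rewrite inE s0 setU0 => /andP[].
Qed.

Definition opt {R : realType} {E : finType} {k : nat} (F : {set {set E}})
    (f : config E k -> R) : R :=
  maxval (fun p : config E k => supp p \in F) f.

Definition dt_max {R : realType} {E : finType} {k : nat}
    (f : config E k -> R) : R :=
  maxval xpredT (fun x : E * 'I_k => f (single x.1 x.2)).

(* Current p, current threshold w, and the numbers of evaluations of f and of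
   independence queries made so far. *)
Record dt_state (R : realType) (E : finType) (k : nat) := DTState {
  dt_cur : config E k;
  dt_thr : R;
  dt_evals : nat;
  dt_queries : nat }.

(* Computing d takes one evaluation of f per pair (e, i). *)
Definition dt_init {R : realType} {E : finType} {k : nat}
    (f : config E k -> R) : dt_state R E k :=
  DTState cfg0 (dt_max f) (#|E| * k)%N 0%N.

(* The for-loop body for e. F(p) always refers to the current p; inside the
   for-loop it is not recomputed as a set after each insertion but tested on
   demand: membership of e takes one query (none if e is in supp p). Each
   of the k values Delta_{e,i} f (p) takes two evaluations. [sel p e] is the
   chosen label in argmax_i Delta_{e,i} f (p). *)
Definition dt_visit {R : realType} {E : finType} {k : nat} (F : {set {set E}})
    (f : config E k -> R) (sel : config E k -> E -> 'I_k)
    (s : dt_state R E k) (e : E) : dt_state R E k :=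
  let: DTState p w a b := s in
  if e \in supp p then s
  else if e \notin feasible F p then DTState p w a b.+1
  else if w <= gain f p e (sel p e)
       then DTState (assign p e (sel p e)) w (a + 2 * k)%N b.+1
       else DTState p w (a + 2 * k)%N b.+1.

(* One iteration of the while-loop, scanning the elements in the order l; the
   whole set F(p) is then computed for the next loop test, which takes one
   query per element outside supp p. *)
Definition dt_pass {R : realType} {E : finType} {k : nat} (F : {set {set E}})
    (f : config E k -> R) (eps : R) (sel : config E k -> E -> 'I_k)
    (l : seq E) (s : dt_state R E k) : dt_state R E k :=
  let: DTState p w a b := foldl (dt_visit F f sel) s l in
  DTState p ((1 - eps) * w) a (b + #|~: supp p|)%N.

Definition dt_active {R : realType} {E : finType} {k : nat} (F : {set {set E}})
    (r : nat) (f : config E k -> R) (eps : R) (s : dt_state R E k) : bool :=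
  ((1 - eps) * eps / (2 * r%:R) * dt_max f < dt_thr s)
  && (feasible F (dt_cur s) != set0).

(* State after t iterations of the while-loop (frozen once the loop test
   fails), where the (t+1)-st for-loop scans E in the order [ord t]. *)
Fixpoint dt_run {R : realType} {E : finType} {k : nat} (F : {set {set E}})
    (r : nat) (f : config E k -> R) (eps : R) (ord : nat -> seq E)
    (sel : config E k -> E -> 'I_k) (t : nat) : dt_state R E k :=
  if t is t'.+1 then
    let s := dt_run F r f eps ord sel t' in
    if dt_active F r f eps s then dt_pass F f eps sel (ord t') s else s
  else dt_init f.

Definition dt_halted {R : realType} {E : finType} {k : nat} (F : {set {set E}})
    (r : nat) (f : config E k -> R) (eps : R) (s : dt_state R E k) : Prop :=
  ~~ dt_active F r f eps s.

Lemma dt_run_halted (R : realType) (E : finType) (k : nat) (F : {set {set E}})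
    (r : nat) (f : config E k -> R) (eps : R) (ord : nat -> seq E)
    (sel : config E k -> E -> 'I_k) (T t : nat) :
  dt_halted F r f eps (dt_run F r f eps ord sel T) -> (T <= t)%N ->
  dt_run F r f eps ord sel t = dt_run F r f eps ord sel T.
Proof.
move=> hT; elim: t => [|t IH]; first by rewrite leqn0 => /eqP->.
rewrite leq_eqVlt => /predU1P[->//|]; rewrite ltnS => /IH /= ->.
by rewrite (negbTE hT).
Qed.

(* Every for-loop scans each element of E once; elements outside the current
   F(p) are skipped by [dt_visit]. *)
Definition scan_orders {E : finType} (ord : nat -> seq E) : Prop :=
  forall t, perm_eq (ord t) (enum E).

Definition argmax_rule {R : realType} {E : finType} {k : nat}
    (f : config E k -> R) (sel : config E k -> E -> 'I_k) : Prop :=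
  forall p e, e \notin supp p -> forall i, gain f p e i <= gain f p e (sel p e).

Definition oracle_work {R : realType} {E : finType} {k : nat} (EO IO : R)
    (s : dt_state R E k) : R :=
  (dt_evals s)%:R * EO + (dt_queries s)%:R * IO.

(* Main.v *)
(* Write g for the gain of the greedy insertion of e into p, and kap = 0 or 1
   according to whether f is monotone or not. The optimum is transformed along
   with p into independent configurations o above p: when e is inserted into p,
   a label of o at some feasible x is erased (matroid exchange) and e gets the
   same label in o as in p. Since x was rejected at the previous threshold
   w / (1 - eps), erasing it costs at most g / (1 - eps); labelling e costs at
   most kap * g, as two distinct labels of e have nonnegative total gain. Hence
   OPT <= f o + (kap + 1 / (1 - eps)) * f p throughout. At the end o adds at
   most r elements to p, each of gain at most eps * d / (2 * r), so that
   f o <= f p + (eps / 2) * OPT.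
   The bound (1 - eps)^t <= exp (- eps * t) limits the number of passes to
   ln (2 * r / eps) / eps + 2, each making at most 2 * n * k evaluations and
   2 * n independence queries. *)

Require Import Defs.
From HB Require Import structures.
From mathcomp Require Import all_boot all_order all_algebra.
From mathcomp Require Import reals sequences exp.
From mathcomp Require Import ring lra zify.

Set Implicit Arguments.
Unset Strict Implicit.
Unset Printing Implicit Defensive.

Import Order.TTheory GRing.Theory Num.Theory.
Local Open Scope ring_scope.

(** * Configurations label by label: meet, join, order, insertion, erasure *)

Lemma mem_part (E : finType) (k : nat) (p : config E k) i e :
  (e \in part p i) = (p e == Some i).
Proof. by rewrite inE. Qed.

Lemma mem_supp (E : finType) (k : nat) (p : config E k) e :
  (e \in supp p) = (p e != None).
Proof.
apply/bigcupP/idP => [[i _]|]; first by rewrite inE => /eqP->.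
by case pe: (p e) => [i|//] _; exists i => //; rewrite inE pe.
Qed.

Lemma kmeetE (E : finType) (k : nat) (p q : config E k) e :
  kmeet p q e = if p e == q e then p e else None.
Proof.
have H i : (kmeet p q e == Some i) = (p e == Some i) && (q e == Some i).
  by rewrite -mem_part part_kmeet !inE.
case: (eqVneq (p e) (q e)) => [pq|npq].
  case pe: (p e) => [i|]; first by apply/eqP; rewrite H -pq pe eqxx.
  case me: (kmeet p q e) => [i|//].
  by have := H i; rewrite me pe eqxx.
case me: (kmeet p q e) => [i|//].
have := H i; rewrite me eqxx => /esym/andP[/eqP pe /eqP qe].
by rewrite pe qe eqxx in npq.
Qed.

(** Two different labels at [e] cancel, since each part loses the elements of all the others. With
    this pointwise form, joins are computed by cases on the labels of one element. *)
Lemma kjoinE (E : finType) (k : nat) (p q : config E k) e :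
  kjoin p q e = match p e, q e with
    | None, b => b
    | a, None => a
    | Some i, Some j => if i == j then Some i else None
    end.
Proof.
have H i : (kjoin p q e == Some i) =
    [forall j, (j != i) ==> (p e != Some j) && (q e != Some j)]
    && ((p e == Some i) || (q e == Some i)).
  rewrite -mem_part part_kjoin finset.in_setD !inE; congr (_ && _).
  apply/idP/forallP => [/bigcupP nU j|nU].
    apply/implyP => ji; rewrite -negb_or; apply/negP => U; apply: nU.
    by exists j => //; rewrite !inE.
  apply/negP => /bigcupP[j ji]; rewrite !inE => U.
  by have := nU j; rewrite ji -negb_or U.
case pe: (p e) H => [i|]; case qe: (q e) => [j|] H.
- case: (eqVneq i j) H => [<-|nij] H.
    apply/eqP; rewrite H eqxx andbT; apply/forallP => l; apply/implyP => li.
    by rewrite andbb; apply: contra li => /eqP[->].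
  case je: (kjoin p q e) => [l|//]; have := H l.
  rewrite je eqxx => /esym/andP[/forallP all_l].
  move=> /orP[/eqP[il]|/eqP[jl]].
    by have := all_l j; rewrite -il eq_sym nij eqxx andbF.
  by have := all_l i; rewrite -jl nij eqxx.
- apply/eqP; rewrite H eqxx andbT; apply/forallP => l; apply/implyP => li.
  by rewrite andbT; apply: contra li => /eqP[->].
- apply/eqP; rewrite H eqxx andbT; apply/forallP => l; apply/implyP => li.
  by apply: contra li => /eqP[->].
- by case je: (kjoin p q e) => [l|//]; have := H l; rewrite je eqxx andbF.
Qed.

Lemma kpreceqP (E : finType) (k : nat) (p q : config E k) :
  kpreceq p q <-> (forall e i, p e = Some i -> q e = Some i).
Proof.
split=> [pq e i pe|pq i].
  by have /subsetP/(_ e) := pq i; rewrite !inE pe eqxx => /(_ isT)/eqP.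
by apply/subsetP => e; rewrite !inE => /eqP/pq ->.
Qed.

Lemma kpreceq_refl (E : finType) (k : nat) (p : config E k) : kpreceq p p.
Proof. by move=> i. Qed.

Lemma kpreceq_supp (E : finType) (k : nat) (p q : config E k) :
  kpreceq p q -> supp p \subset supp q.
Proof.
move=> /kpreceqP pq; apply/subsetP => e; rewrite !mem_supp.
by case pe: (p e) => [i|//] _; rewrite (pq _ _ pe).
Qed.

Lemma kpreceq_assign (E : finType) (k : nat) (p q : config E k) e i :
  p e = None -> kpreceq p q -> kpreceq p (assign q e i).
Proof.
move=> pe /kpreceqP pq; apply/kpreceqP => x j px; rewrite ffunE.
by case: eqP => [xe|_]; [rewrite -xe px in pe | exact: pq].
Qed.

Lemma assign_kpreceq (E : finType) (k : nat) (p q : config E k) e i :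
  kpreceq p q -> kpreceq (assign p e i) (assign q e i).
Proof.
move=> /kpreceqP pq; apply/kpreceqP => x j; rewrite !ffunE.
by case: eqP => // _; exact: pq.
Qed.

Lemma kpreceq_cfg0 (E : finType) (k : nat) (p : config E k) : kpreceq cfg0 p.
Proof. by apply/kpreceqP => e i; rewrite ffunE. Qed.

Lemma supp_cfg0 (E : finType) (k : nat) : supp (@cfg0 E k) = set0.
Proof. by apply/setP => e; rewrite mem_supp ffunE inE. Qed.

Lemma supp_assign (E : finType) (k : nat) (p : config E k) e i :
  supp (assign p e i) = (e |: supp p)%SET.
Proof.
by apply/setP => x; rewrite !inE !mem_supp ffunE; case: (x =P e).
Qed.

Definition erase (E : finType) (k : nat) (p : config E k) (x : E) :
  config E k := [ffun y => if y == x then None else p y].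

Lemma supp_erase (E : finType) (k : nat) (p : config E k) x :
  supp (erase p x) = (supp p :\ x)%SET.
Proof. by apply/setP => y; rewrite !inE !mem_supp ffunE; case: (y =P x). Qed.

Lemma assign_erase (E : finType) (k : nat) (p : config E k) x i :
  p x = Some i -> assign (erase p x) x i = p.
Proof. by move=> px; apply/ffunP => y; rewrite !ffunE; case: eqP => // ->. Qed.

Lemma erase_id (E : finType) (k : nat) (p : config E k) x :
  p x = None -> erase p x = p.
Proof. by move=> px; apply/ffunP => y; rewrite !ffunE; case: eqP => // ->. Qed.

Lemma kpreceq_erase (E : finType) (k : nat) (p q : config E k) x :
  p x = None -> kpreceq p q -> kpreceq p (erase q x).
Proof.
move=> px /kpreceqP pq; apply/kpreceqP => y j py; rewrite ffunE.
by case: eqP => [yx|_]; [rewrite -yx py in px | exact: pq].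
Qed.

(** * Diminishing returns and pairwise monotonicity of k-submodular functions *)

Section KSubmodular.
Variables (R : realType) (E : finType) (k : nat) (f : config E k -> R).
Hypothesis fsub : ksubmodular f.

(** k-submodularity is applied to [assign p e i] and [q]: no labels conflict, so the join is
    [assign q e i] and the meet is [p]. *)
Lemma gain_anti (p q : config E k) e i :
  kpreceq p q -> q e = None -> gain f q e i <= gain f p e i.
Proof.
move=> /kpreceqP pq qe.
have pe : p e = None.
  by case pe: (p e) => [j|//]; rewrite (pq _ _ pe) in qe.
have := fsub (assign p e i) q.
have -> : kjoin (assign p e i) q = assign q e i.
  apply/ffunP => x; rewrite kjoinE !ffunE; case: (x =P e) => [->|_].
    by rewrite qe.
  case px: (p x) => [j|//].
  by rewrite (pq _ _ px) eqxx.
have -> : kmeet (assign p e i) q = p.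
  apply/ffunP => x; rewrite kmeetE !ffunE; case: (x =P e) => [->|_].
    by rewrite qe pe.
  case px: (p x) => [j|]; first by rewrite (pq _ _ px) eqxx.
  by case: (q x).
rewrite /gain; lra.
Qed.

(** The two insertions conflict exactly at [e], so their join and their meet both collapse to
    [p]. *)
Lemma gain_pairwise (p : config E k) e i j :
  p e = None -> i != j -> 0 <= gain f p e i + gain f p e j.
Proof.
move=> pe ij; have := fsub (assign p e i) (assign p e j).
have -> : kjoin (assign p e i) (assign p e j) = p.
  apply/ffunP => x; rewrite kjoinE !ffunE; case: (x =P e) => [->|_].
    by rewrite (negbTE ij) pe.
  by case: (p x) => // l; rewrite eqxx.
have -> : kmeet (assign p e i) (assign p e j) = p.
  apply/ffunP => x; rewrite kmeetE !ffunE; case: (x =P e) => [->|_]; last by rewrite eqxx.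
  by rewrite pe; case: eqP => // -[] /eqP; rewrite (negbTE ij).
rewrite /gain; lra.
Qed.

(** Going down from [q] to [p] by erasing one element at a time, each erasure costs a gain over a
    configuration above [p], hence at most the corresponding gain over [p] itself. *)
Lemma le_sum_gains (p q : config E k) (g : R) :
  kpreceq p q ->
  (forall e i, e \in (supp q :\: supp p)%SET -> gain f p e i <= g) ->
  f q <= f p + #|(supp q :\: supp p)%SET|%:R * g.
Proof.
move: {2}#|_| (leqnn #|(supp q :\: supp p)%SET|) => n.
elim: n q => [|n IH] q; first rewrite leqn0 cards_eq0 => /eqP D0.
  move=> /kpreceqP pq _; rewrite D0 cards0 mul0r addr0.
  have -> // : q = p.
  apply/ffunP => x; case px: (p x) => [i|]; first exact: pq.
  apply/eqP; have := in_set0 x; rewrite -D0 inE !mem_supp px /=.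
  by move/negbFE.
move=> le_n pq ge_g.
have [D0|[x xD]] := set_0Vmem (supp q :\: supp p)%SET.
  by apply: IH => //; rewrite D0 cards0.
have [px xq] : p x = None /\ x \in supp q.
  by move: xD; rewrite !inE mem_supp negbK => /andP[/eqP].
have [i qx] : exists i, q x = Some i.
  by move: xq; rewrite mem_supp; case: (q x) => // i _; exists i.
have pq' := kpreceq_erase px pq.
have DE : (supp (erase q x) :\: supp p = (supp q :\: supp p) :\ x)%SET.
  by rewrite supp_erase; apply/setP => y; rewrite !inE andbCA.
have cardD : #|(supp q :\: supp p)%SET| = #|(supp (erase q x) :\: supp p)%SET|.+1.
  by rewrite DE (cardsD1 x) xD.
have := IH (erase q x) _ pq' _.
rewrite cardD ltnS in le_n => /(_ le_n).
have gx : gain f (erase q x) x i <= g.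
  by apply: (le_trans (gain_anti _ pq' _)); rewrite ?ge_g // ffunE eqxx.
have gE : forall e j, e \in (supp (erase q x) :\: supp p)%SET -> gain f p e j <= g.
  by move=> e j; rewrite DE inE => /andP[_]; exact: ge_g.
move=> /(_ gE); rewrite cardD -natr1.
move: gx; rewrite /gain assign_erase //; lra.
Qed.

End KSubmodular.

(** * Matroid rank and exchange *)

Lemma matroid_card_le_rank (E : finType) (F : {set {set E}}) r (A : {set E}) :
  matroid_rank F r -> A \in F -> (#|A| <= r)%N.
Proof.
move=> rkF AF; have [B mB AB] := @maxset_exists E (fun A => A \in F) A AF.
by rewrite -(rkF B mB); exact: subset_leq_card.
Qed.

(* [x = e] covers both the case [e \in B] and the case where [e] can be added
   to [B] without removing anything. *)
Lemma matroid_exchange (E : finType) (F : {set {set E}}) (A B : {set E}) e :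
  matroid F -> A \subset B -> B \in F -> e \notin A -> (e |: A)%SET \in F ->
  exists2 x, x \notin A & (e \notin B :\ x)%SET /\ (e |: B :\ x)%SET \in F.
Proof.
move=> [_ dcF augF] AB BF eA eAF.
have [eB|eB] := boolP (e \in B).
  by exists e; rewrite // setD1K // !inE eqxx.
have [eBF|eBF] := boolP ((e |: B)%SET \in F).
  have -> : B = (B :\ e)%SET by apply/esym/setDidPl; rewrite disjoint_sym disjoints1.
  exists e; rewrite // setDDl setUid; split; first by rewrite !inE eqxx.
  by apply: (dcF _ _ eBF); apply/setUS/subsetDl.
(* A maximal independent [M] between [e |: A] and [e |: B] will turn out to be [B] with one element
   traded for [e]. *)
pose P := fun M : {set E} => (M \in F) && (M \subset (e |: B)%SET).
have P0 : P (e |: A)%SET by rewrite /P eAF setUS.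
have [M /maxsetP[/andP[MF MeB] maxM] eAM] := maxset_exists P0.
(* Otherwise some element of [B] would augment [M] inside [e |: B], against maximality. *)
have cM : (#|B| <= #|M|)%N.
  rewrite leqNgt; apply/negP => /(augF _ _ MF BF) [y].
  rewrite inE => /andP[yM yB] yMF.
  have := maxM (y |: M)%SET; rewrite /P yMF subUset sub1set inE yB orbT MeB.
  by move=> /(_ isT (subsetUr _ _)) yME; rewrite -yME setU11 in yM.
(* The set [e |: B] is dependent, so [M] misses some [x]; by cardinality it misses nothing else. *)
have [x xeB xM] : exists2 x, x \in (e |: B)%SET & x \notin M.
  apply/subsetPn; apply: contra eBF => eBM.
  by have <- : M = (e |: B)%SET by apply/eqP; rewrite eqEsubset MeB.
have eM : e \in M by apply: (subsetP eAM); rewrite setU11.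
have xe : x != e by apply: contraNneq xM => ->.
have xB : x \in B by move: xeB; rewrite !inE (negbTE xe).
exists x; first by apply: contra xM => xA; apply: (subsetP eAM); rewrite inE xA orbT.
split; first by rewrite !inE (negbTE eB) andbF.
suff <- : M = (e |: B :\ x)%SET by [].
apply/eqP; rewrite eqEcard; apply/andP; split.
  apply/subsetP => y yM; have := subsetP MeB _ yM; rewrite !inE.
  by case: (eqVneq y x) yM xM => [-> ->|].
by rewrite cardsU1 !inE (negbTE eB) andbF; move: cM; rewrite (cardsD1 x B) xB.
Qed.

(** * Maxima, feasible elements and geometric decay *)

Lemma maxval_ge (R : realType) (T : finType) (P : pred T) (g : T -> R) x :
  P x -> g x <= maxval P g.
Proof.
rewrite /maxval => Px; case: pickP => [y Py|/(_ x)]; last by rewrite Px.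
by case: arg_maxP => // z _; apply.
Qed.

Lemma maxval_attained (R : realType) (T : finType) (P : pred T) (g : T -> R) x :
  P x -> exists2 y, P y & maxval P g = g y.
Proof.
rewrite /maxval => Px; case: pickP => [y Py|/(_ x)]; last by rewrite Px.
by case: arg_maxP => // z Pz _; exists z.
Qed.

Lemma feasibleP (E : finType) (k : nat) (F : {set {set E}}) (p : config E k) e :
  reflect (p e = None /\ (e |: supp p)%SET \in F) (e \in feasible F p).
Proof.
rewrite inE mem_supp negbK.
by apply: (iffP andP) => -[/eqP].
Qed.

(** By downward closure. Together with [gain_anti] it lets gain bounds obtained for an earlier
    configuration survive later insertions. *)
Lemma feasible_anti (E : finType) (k : nat) (F : {set {set E}})
    (p q : config E k) : matroid F -> kpreceq p q ->
  feasible F q \subset feasible F p.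
Proof.
move=> [_ dcF _] pq; apply/subsetP => e /feasibleP[qe eqF].
apply/feasibleP; split; last exact: dcF eqF (setUS _ (kpreceq_supp pq)).
by move/kpreceqP in pq; case pe: (p e) => [i|//]; rewrite (pq _ _ pe) in qe.
Qed.

Lemma expr_le_inv (R : realType) (eps y : R) t :
  0 < eps < 1 -> 0 < y -> ln y / eps <= t%:R -> (1 - eps) ^+ t <= y^-1.
Proof.
case/andP=> eps0 eps1 y0; rewrite ler_pdivrMr // => ln_le.
have -> : y^-1 = expR (- ln y) by rewrite expRN lnK.
apply: (@le_trans _ _ (expR (- eps) ^+ t)).
  by rewrite lerXn2r ?nnegrE ?expR_ge0 ?subr_ge0 ?expR_ge1Dx // ltW.
by rewrite -expRM_natr ler_expR mulNr lerN2 mulrC.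
Qed.

(** * The transformed optimum and the invariant of the loops *)

Section Procedure.
Variables (R : realType) (E : finType) (k r : nat) (F : {set {set E}}).
Variables (f : config E k -> R) (eps : R) (ord : nat -> seq E).
Variable sel : config E k -> E -> 'I_k.
Hypotheses (matF : matroid F) (rkF : matroid_rank F r) (loopF : loopless F).
Hypotheses (fsub : ksubmodular f) (f0 : f cfg0 = 0).
Hypotheses (eps01 : 0 < eps < 1).
Hypotheses (ordE : scan_orders ord) (selP : argmax_rule f sel).

Let run := dt_run F r f eps ord sel.
(** The ratio between a threshold and the next one. *)
Let u := (1 - eps)^-1.

Let eps_gt0 : 0 < eps. Proof. by case/andP: eps01. Qed.
Let eps_lt1 : eps < 1. Proof. by case/andP: eps01. Qed.
Let eps'_gt0 : 0 < 1 - eps. Proof. by rewrite subr_gt0. Qed.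
Let u_ge1 : 1 <= u.
Proof. by rewrite invf_ge1 //; move: eps_gt0; lra. Qed.

Section Approximation.
(* [kap = 0] works in the monotone case; in general [kap = 1] does, by pairwise
   monotonicity. *)
Variable kap : R.
Hypothesis lossP : forall p q e, kpreceq p q -> q e = None ->
  - gain f q e (sel p e) <= kap * gain f p e (sel p e).
Hypothesis max_ge0 : 0 <= dt_max f.

Lemma exchange_step (p o : config E k) e (w : R) :
  supp o \in F -> kpreceq p o -> e \in feasible F p ->
  (forall x j, x \in feasible F p -> gain f p x j <= u * w) ->
  0 <= w -> w <= gain f p e (sel p e) ->
  exists o', [/\ supp o' \in F, kpreceq (assign p e (sel p e)) o' &
    f o <= f o' + (kap + u) * gain f p e (sel p e)].
Proof.
move=> oF po /feasibleP[pe eF] gw w0 wg.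
have [_ dcF _] := matF.
have eNp : e \notin supp p by rewrite mem_supp pe.
(* Erasing [x] from [o] makes room for [e], and [x] lies outside [p], so the new configuration stays
   above [p]. *)
have [x xNp [eNo' o'F]] := matroid_exchange matF (kpreceq_supp po) oF eNp eF.
have px : p x = None by apply/eqP; rewrite mem_supp negbK in xNp.
have pq := kpreceq_erase px po.
rewrite -supp_erase mem_supp negbK in eNo'; move/eqP: eNo' => qe.
exists (assign (erase o x) e (sel p e)); split.
- by rewrite supp_assign supp_erase.
- exact: assign_kpreceq.
have u0 : 0 <= u by rewrite (le_trans ler01).
have le_erase : f o <= f (erase o x) + u * gain f p e (sel p e).
  (* If [x] has no label in [o], erasing it changes nothing; this includes [x = e] when [e] can
     simply be added. *)
  case ox: (o x) => [j|]; last first.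
    by rewrite erase_id // lerDl mulr_ge0 // (le_trans w0).
  (* Both [x] and [supp p] lie in the independent set [supp o], so the bound [u * w] on gains over
     [p] applies to [x]. *)
  have xF : x \in feasible F p.
    apply/feasibleP; split=> //; apply: dcF oF _.
    by rewrite subUset sub1set mem_supp ox kpreceq_supp.
  have qx : erase o x x = None by rewrite ffunE eqxx.
  have := le_trans (gain_anti fsub j pq qx) (gw x j xF).
  have := ler_wpM2l u0 wg.
  by rewrite {2}/gain assign_erase //; lra.
have := lossP pq qe; rewrite {1}/gain; move: le_erase; lra.
Qed.

(** The witness [o] is the current transform of the optimum; it depends on the insertions made so
    far, hence the existential. *)
Definition compares (p : config E k) := exists o,
  [/\ supp o \in F, kpreceq p o & opt F f <= f o + (kap + u) * f p].

(** [V] collects the elements already scanned in the current pass. They satisfy the bound of the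
    current threshold, while every feasible element satisfies that of the previous one,
    [u * dt_thr s]. *)
Definition loop_inv (V : {set E}) (s : dt_state R E k) :=
  [/\ supp (dt_cur s) \in F, compares (dt_cur s), 0 <= dt_thr s,
      (forall x j, x \in feasible F (dt_cur s) ->
         gain f (dt_cur s) x j <= u * dt_thr s)
    & (forall x j, x \in feasible F (dt_cur s) -> x \in V ->
         gain f (dt_cur s) x j <= dt_thr s)].

Lemma visit_inv V s e :
  loop_inv V s -> loop_inv (e |: V)%SET (dt_visit F f sel s e).
Proof.
case: s => p w a b [/= pF cmp w0 gu gV]; rewrite /dt_visit.
(* Covers every visit that leaves [p] unchanged. For an infeasible [e] the premise is vacuous;
   otherwise the argmax rule extends the bound from the selected label to all labels. *)
have skip a' b' : (e \in feasible F p -> gain f p e (sel p e) <= w) ->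
    loop_inv (e |: V)%SET (DTState p w a' b').
  move=> ge; split=> //= x j xF; rewrite !inE => /predU1P[xe|]; last exact: gV.
  rewrite xe in xF *; apply: le_trans (ge xF); apply: selP.
  by move: xF; rewrite inE => /andP[].
case: ifP => [ep|_]; first by apply: skip; rewrite inE ep.
case: ifP => [/negP eF|/negbFE eF]; first by apply: skip.
case: ifP => [wg|/negbT]; last by rewrite -ltNge => /ltW ge; apply: skip.
have [o [oF po le_o]] := cmp.
have [o' [o'F po' le_o']] := exchange_step oF po eF gu w0 wg.
have /feasibleP[pe eaF] := eF.
have pp' : kpreceq p (assign p e (sel p e)).
  by apply: kpreceq_assign => //; exact: kpreceq_refl.
(* After an insertion the feasible set and the gains only shrink, so both gain bounds persist. *)
have gain_le x j : x \in feasible F (assign p e (sel p e)) ->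
    x \in feasible F p /\ gain f (assign p e (sel p e)) x j <= gain f p x j.
  move=> xF; split; first exact: subsetP (feasible_anti matF pp') x xF.
  by apply: gain_anti => //; case/feasibleP: xF.
split=> //=.
- by rewrite supp_assign.
- exists o'; split=> //; move: le_o le_o'; rewrite /gain; lra.
- by move=> x j /gain_le-/(_ j)[xF le_x]; apply: le_trans le_x (gu _ _ xF).
move=> x j xF'; have [xF le_x] := gain_le x j xF'.
rewrite !inE => /predU1P[xe|xV]; last exact: le_trans le_x (gV _ _ xF xV).
by move/feasibleP: xF' => []; rewrite ffunE xe eqxx.
Qed.

Lemma fold_inv V s l :
  loop_inv V s -> loop_inv ([set x in l] :|: V)%SET (foldl (dt_visit F f sel) s l).
Proof.
elim: l V s => [|e l IH] V s inv /=.
  by have -> : ([set x in [::]] :|: V)%SET = V by apply/setP => x; rewrite !inE.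
have /IH := visit_inv e inv.
congr loop_inv; apply/setP => x; rewrite !inE.
by rewrite orbCA orbA.
Qed.

(** After a full scan [V] is all of [E], so every feasible gain is at most [w], which equals [u]
    times the lowered threshold; the next pass restarts with [V] empty. *)
Lemma pass_inv t s : loop_inv set0 s -> loop_inv set0 (dt_pass F f eps sel (ord t) s).
Proof.
move=> /fold_inv-/(_ (ord t)); rewrite /dt_pass.
case: (foldl _ _ _) => p w a b [/= pF cmp w0 _ gV]; split=> //=.
- by rewrite mulr_ge0 // ltW.
- move=> x j xF; rewrite mulKf ?gt_eqF //; apply: gV => //.
  by rewrite !inE (perm_mem (ordE t)) mem_enum.
- by move=> x j _; rewrite inE.
Qed.

Lemma gain_cfg0 e i : gain f cfg0 e i <= dt_max f.
Proof.
rewrite /gain f0 subr0.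
exact: (maxval_ge (fun x : E * 'I_k => f (single x.1 x.2)) (x := (e, i))).
Qed.

Lemma run_inv t : loop_inv set0 (run t).
Proof.
elim: t => [|t IH]; last by rewrite /run /=; case: ifP => // _; exact: pass_inv.
have F0 : supp (@cfg0 E k) \in F by rewrite supp_cfg0; case: matF.
split=> //=.
- have [o oF oE] := maxval_attained (P := fun p : config E k => supp p \in F) f F0.
  by exists o; split=> //; [exact: kpreceq_cfg0 | rewrite f0 mulr0 addr0 /opt oE].
- by move=> e i _; rewrite (le_trans (gain_cfg0 e i)) // ler_peMl.
- by move=> e i _; rewrite inE.
Qed.

Lemma opt_ge0 : 0 <= opt F f.
Proof.
rewrite -f0; apply: (maxval_ge (P := fun p : config E k => supp p \in F)).
by rewrite supp_cfg0; case: matF.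
Qed.

(** Looplessness makes every single-element configuration a candidate for [opt]; if there is no pair
    of element and label, [dt_max f] is the default 0. *)
Lemma dt_max_le_opt : dt_max f <= opt F f.
Proof.
rewrite /dt_max {1}/maxval; case: pickP => [y _|_]; last exact: opt_ge0.
case: arg_maxP => // -[e i] _ _.
apply: (maxval_ge (P := fun p : config E k => supp p \in F)).
by rewrite supp_assign supp_cfg0 setU0; exact: loopF.
Qed.

Lemma run_halted_bound t : dt_halted F r f eps (run t) ->
  opt F f <= f (dt_cur (run t)) + eps / 2 * opt F f
             + (kap + u) * f (dt_cur (run t)).
Proof.
move=> halt; have [pF [o [oF po le_o]] w0 gu _] := run_inv t.
set p := dt_cur _ in pF po le_o gu *; set w := dt_thr _ in w0 gu.
apply: (le_trans le_o); rewrite lerD2r.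
set g := eps / (2 * r%:R) * dt_max f.
have g0 : 0 <= g.
  by rewrite /g mulr_ge0 // divr_ge0 ?mulr_ge0 ?ler0n // ltW.
(* Any such [x] is still feasible, so the loop must have stopped because of the threshold; the
   factor [1 - eps] in the stopping threshold cancels [u]. *)
have small x j : x \in (supp o :\: supp p)%SET -> gain f p x j <= g.
  rewrite inE => /andP[xp xo].
  have xF : x \in feasible F p.
    rewrite inE xp /=; case: matF => _ dcF _; apply: dcF oF _.
    by rewrite subUset sub1set xo kpreceq_supp.
  have F0 : feasible F p != set0 by apply/set0Pn; exists x.
  move: halt; rewrite /dt_halted /dt_active F0 andbT -leNgt => w_le.
  apply: (le_trans (gu x j xF)).
  rewrite /u ler_pdivrMl //; apply: (le_trans w_le).
  by rewrite /g !mulrA.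
apply: (le_trans (le_sum_gains fsub po small)); rewrite lerD2l.
have le_r : (#|(supp o :\: supp p)%SET| <= r)%N.
  exact: leq_trans (subset_leq_card (subsetDl _ _)) (matroid_card_le_rank rkF oF).
apply: (@le_trans _ _ (r%:R * g)); first by rewrite ler_wpM2r // ler_nat.
(* For [r = 0] the left side is 0; otherwise [r] cancels against the denominator of [g]. *)
have [r0|r0] := eqVneq r 0%N.
  rewrite r0 mul0r mulr_ge0 ?opt_ge0 // divr_ge0 // ltW //.
have r0' : r%:R != 0 :> R by rewrite pnatr_eq0.
have -> : r%:R * g = eps / 2 * dt_max f by rewrite /g; field.
by rewrite ler_wpM2l ?dt_max_le_opt // divr_ge0 // ltW.
Qed.

End Approximation.

(** * Independence, termination and oracle counts *)

Lemma run_supp t : supp (dt_cur (run t)) \in F.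
Proof.
have visitF s e : supp (dt_cur s) \in F ->
    supp (dt_cur (dt_visit F f sel s e)) \in F.
  case: s => p w a b /= pF; case: ifP => // _.
  case: ifP => [//|/negbFE /feasibleP[_ eF]].
  by case: ifP => //= _; rewrite supp_assign.
have foldF l s : supp (dt_cur s) \in F ->
    supp (dt_cur (foldl (dt_visit F f sel) s l)) \in F.
  by elim: l s => //= e l IH s /(visitF _ e); exact: IH.
elim: t => [|t IH]; first by rewrite /= supp_cfg0; case: matF.
rewrite /run /=; case: ifP => // _; rewrite /dt_pass.
by have := foldF (ord t) _ IH; case: (foldl _ _ _).
Qed.

Lemma fold_thr l s : dt_thr (foldl (dt_visit F f sel) s l) = dt_thr s.
Proof.
elim: l s => //= e l IH s; rewrite IH.
case: s => p w a b /=.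
by case: ifP => // _; case: ifP => // _; case: ifP.
Qed.

(** A state that is still active was never frozen before, so the threshold has been lowered exactly
    [t] times. *)
Lemma run_thr t : dt_active F r f eps (run t) ->
  dt_active F r f eps (run 0) /\ dt_thr (run t) = (1 - eps) ^+ t * dt_max f.
Proof.
elim: t => [|t IH]; first by rewrite mul1r.
rewrite /run /=; case: ifP => [act _|/negP//].
have [act0 thr] := IH act; split=> //.
rewrite exprS -mulrA -thr -(fold_thr (ord t) (run t)) /dt_pass /run.
by case: (foldl _ _ _).
Qed.

Lemma rank_gt0_of_feasible (p : config E k) : feasible F p != set0 -> (0 < r)%N.
Proof.
case/set0Pn => e /feasibleP[_ eF].
apply: leq_trans (matroid_card_le_rank rkF eF).
by apply/card_gt0P; exists e; rewrite setU11.
Qed.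

(** The extra pass absorbs the factor [1 - eps] of the stopping threshold: activity after [t.+1]
    passes would give [(1 - eps) ^+ t > eps / (2 * r)], against [expr_le_inv]. *)
Lemma run_halted t : ((0 < r)%N -> ln (2 * (r%:R / eps)) / eps <= t%:R) ->
  dt_halted F r f eps (run t.+1).
Proof.
move=> t_ge; apply/negP => act; have [act0 thr] := run_thr act.
have [/andP[w_gt F0] /andP[w0_gt _]] := (act, act0).
have r_gt0 := rank_gt0_of_feasible F0.
have r0 : 0 < r%:R :> R by rewrite ltr0n.
set c := (1 - eps) * eps / (2 * r%:R) in w_gt w0_gt.
have c_lt1 : c < 1.
  rewrite /c ltr_pdivrMr ?mulr_gt0 // mul1r.
  have : 1 <= r%:R :> R by rewrite ler1n.
  have : eps * eps >= 0 by rewrite mulr_ge0 // ltW.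
  by move: eps_lt1; nra.
(* The initial test reads [c * d < d] with [c < 1], which forces [d] to be positive. *)
have d_gt0 : 0 < dt_max f.
  by move: w0_gt; rewrite /= -subr_gt0 -{1}[dt_max f]mul1r -mulrBl pmulr_rgt0 // subr_gt0.
move: w_gt; rewrite thr ltr_pM2r // /c exprS -mulrA ltr_pM2l // => lt_pow.
have y_gt0 : 0 < 2 * (r%:R / eps) by rewrite mulr_gt0 // divr_gt0.
have := lt_le_trans lt_pow (expr_le_inv eps01 y_gt0 (t_ge r_gt0)).
by rewrite mulrA invf_div ltxx.
Qed.

Lemma fold_counts l s (s' := foldl (dt_visit F f sel) s l) :
  (dt_evals s' <= dt_evals s + size l * (2 * k))%N /\
  (dt_queries s' <= dt_queries s + size l)%N.
Proof.
rewrite {}/s'; elim: l s => [|e l IH] s /=; first by rewrite !addn0.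
have [le_a le_b] := IH (dt_visit F f sel s e).
have [le_a' le_b'] :
    (dt_evals (dt_visit F f sel s e) <= dt_evals s + 2 * k)%N /\
    (dt_queries (dt_visit F f sel s e) <= dt_queries s + 1)%N.
  case: s {IH le_a le_b} => p w a b /=.
  case: ifP => _; [|case: ifP => _; [|case: ifP => _]] => /=;
  by rewrite ?addn1 ?leq_addr ?leqnSn ?leqnn.
by split; [apply: leq_trans le_a _ | apply: leq_trans le_b _]; nia.
Qed.

(** The summand 1 pays for computing [d]. In each pass an element costs at most [2 * k] evaluations,
    one query when scanned and one when the feasible set is recomputed. *)
Lemma run_counts t :
  (dt_evals (run t) <= #|E| * k * (1 + 2 * t))%N /\
  (dt_queries (run t) <= #|E| * (2 * t))%N.
Proof.
elim: t => [|t [IHa IHb]]; first by rewrite /= !muln1 !muln0.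
rewrite /run /= -/(run t); case: ifP => _; last first.
  split; [apply: leq_trans IHa _ | apply: leq_trans IHb _];
  by rewrite leq_mul2l ?leq_add2l ?leq_mul2l leqnSn ?orbT.
rewrite /dt_pass; have [] := fold_counts (ord t) (run t).
case: (foldl _ _ _) => p w a b /=.
rewrite (perm_size (ordE t)) -cardE => le_a le_b; split.
  apply: (leq_trans le_a); rewrite mulnS addnCA [X in (_ <= X)%N]mulnDr addnC.
  by rewrite leq_add // -mulnA [(k * 2)%N]mulnC.
apply: (@leq_trans (dt_queries (run t) + #|E| + #|E|)).
  by rewrite leq_add // max_card.
by rewrite mulnS mulnDr mulnS muln1 [leqRHS]addnC addnA !leq_add.
Qed.

(** * Approximation ratios and total work *)

(** Multiplying the bound at termination by [1 - eps] clears [u] and leaves a positive coefficient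
    in front of [f p]. Comparing coefficients of the nonnegative optimum after multiplying by it
    works whatever the sign of the ratio. *)
Lemma run_approx kap t : 0 <= kap ->
  (forall p q e, kpreceq p q -> q e = None ->
     - gain f q e (sel p e) <= kap * gain f p e (sel p e)) ->
  0 <= dt_max f -> dt_halted F r f eps (run t) ->
  ((2 + kap)^-1 - eps) * opt F f <= f (dt_cur (run t)).
Proof.
move=> kap0 lossP max0 /(run_halted_bound lossP max0).
set P := f _; have := opt_ge0; set O := opt F f => O0 O_le.
have le_mul : (1 - eps / 2) * (1 - eps) * O <= (2 + kap - (1 + kap) * eps) * P.
  have -> : (2 + kap - (1 + kap) * eps) * P = (1 - eps) * ((1 + kap + u) * P).
    by rewrite /u; field; apply: lt0r_neq0; move: eps_lt1; lra.
  have -> : (1 - eps / 2) * (1 - eps) * O = (1 - eps) * (O - eps / 2 * O) by ring.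
  by rewrite ler_pM2l //; move: O_le; lra.
have D_gt0 : 0 < 2 + kap - (1 + kap) * eps.
  have -> : 2 + kap - (1 + kap) * eps = 1 + (1 + kap) * (1 - eps) by ring.
  by rewrite ltr_wpDr // mulr_ge0 ?(ltW eps'_gt0) // addr_ge0.
rewrite -(ler_pM2l D_gt0); apply: le_trans le_mul.
rewrite mulrA ler_wpM2r // -subr_ge0.
have m_gt0 : 0 < 2 + kap by rewrite ltr_wpDr.
(* The difference of the two coefficients factors into visibly nonnegative terms. *)
have -> : (1 - eps / 2) * (1 - eps)
    - (2 + kap - (1 + kap) * eps) * ((2 + kap)^-1 - eps)
  = eps * ((1 + kap) / (2 + kap) + (2^-1 + kap) * (1 - eps)).
  by field; apply: lt0r_neq0; move: m_gt0; lra.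
have kap'_ge0 : 0 <= 1 + kap by rewrite addr_ge0.
rewrite mulr_ge0 ?(ltW eps_gt0) // addr_ge0 ?divr_ge0 ?(ltW m_gt0) //.
by rewrite mulr_ge0 ?(ltW eps'_gt0) // addr_ge0 // invr_ge0.
Qed.

Lemma dt_max_ge0 :
  (forall e : E, 'I_k -> exists i, 0 <= f (single e i)) -> 0 <= dt_max f.
Proof.
rewrite /dt_max /maxval => ex_ge0; case: pickP => [[e0 i0] _|//].
case: arg_maxP => // x _ le_x; have [i fi] := ex_ge0 e0 i0.
by apply: (le_trans fi); exact: (le_x (e0, i)).
Qed.

Lemma run_approx_monotone t : kmonotone f -> dt_halted F r f eps (run t) ->
  (1 / 2 - eps) * opt F f <= f (dt_cur (run t)).
Proof.
move=> fmon halt; have := @run_approx 0 t; rewrite addr0 div1r.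
apply=> //; last first.
  apply: dt_max_ge0 => e i; exists i; rewrite -f0; apply: fmon.
  exact: kpreceq_cfg0.
move=> p q e pq qe; rewrite mul0r oppr_le0 subr_ge0; apply: fmon.
exact: kpreceq_assign qe (@kpreceq_refl _ _ q).
Qed.

Lemma run_approx_nonmonotone t : (2 <= k)%N -> dt_halted F r f eps (run t) ->
  (1 / 3 - eps) * opt F f <= f (dt_cur (run t)).
Proof.
move=> k2 halt.
(* Pairwise monotonicity needs a second label, supplied by [2 <= k]. *)
have other (i : 'I_k) : exists j, i != j.
  case: (eqVneq i (Ordinal k2)) => [->|]; last by exists (Ordinal k2).
  by exists (Ordinal (ltnW k2)).
have := @run_approx 1 t; rewrite (_ : 2 + 1 = 3) ?div1r; last by ring.
apply=> //; last first.
  (* The values of [f] at the two singletons have nonnegative sum, so one of them is nonnegative. *)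
  apply: dt_max_ge0 => e i; have [j ij] := other i.
  have c0 : @cfg0 E k e = None by rewrite ffunE.
  have := gain_pairwise fsub c0 ij; rewrite /gain f0 !subr0.
  case: (leP 0 (f (single e i))) => [|neg]; first by exists i.
  by exists j; move: neg; rewrite /single; lra.
(* The loss at the selected label over [q] is at most the gain of [j] over [q], hence over [p],
   hence at most the selected gain over [p]. *)
move=> p q e pq qe; rewrite mul1r; have [j ij] := other (sel p e).
have pe : e \notin supp p.
  by apply: contraL (eqxx (q e)) => /(subsetP (kpreceq_supp pq)); rewrite mem_supp qe.
have := gain_pairwise fsub qe ij; have := gain_anti fsub j pq qe.
have := selP pe j; lra.
Qed.

Lemma run_work t (EO IO : R) : 0 <= EO -> 0 <= IO ->
  oracle_work EO IO (run t) <=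
  #|E|%:R * (k%:R * EO + IO) * (1 + 2 * t%:R).
Proof.
move=> EO0 IO0; have [le_a le_b] := run_counts t.
rewrite /oracle_work.
have -> : #|E|%:R * (k%:R * EO + IO) * (1 + 2 * t%:R) =
    (#|E| * k * (1 + 2 * t))%:R * EO + (#|E| * (1 + 2 * t))%:R * IO.
  by ring.
apply: lerD; apply: ler_wpM2r => //; rewrite ler_nat //.
by apply: (leq_trans le_b); rewrite leq_mul2l leq_addl orbT.
Qed.

End Procedure.

(** * The guarantees with explicit constants *)

Theorem theorem2 (R : realType) (x0 : R) (hx0 : 1 < x0) :
  exists C : R,
  forall (E : finType) (k r : nat) (F : {set {set E}}) (f : config E k -> R)
    (eps : R) (ord : nat -> seq E) (sel : config E k -> E -> 'I_k),
  (1 <= k)%N ->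
  matroid F -> loopless F -> matroid_rank F r ->
  ksubmodular f -> f cfg0 = 0 ->
  0 < eps < 1 ->
  scan_orders ord -> argmax_rule f sel ->
  exists T : nat,
  let s := dt_run F r f eps ord sel T in
  let p := dt_cur s in
  [/\ dt_halted F r f eps s,
      supp p \in F,
      (kmonotone f -> (1 / 2 - eps) * opt F f <= f p),
      (~ kmonotone f -> (2 <= k)%N -> (1 / 3 - eps) * opt F f <= f p)
    & (forall EO IO : R, 0 <= EO -> 0 <= IO -> x0 <= r%:R / eps ->
         oracle_work EO IO s <=
         C * (#|E|%:R * (k%:R * EO + IO) / eps * ln (r%:R / eps)))].
Proof.
have lx0 : 0 < ln x0 by rewrite ln_gt0.
(* With [T] passes, [(1 + 2 * T) * eps] is at most [5 + 2 * (ln 2 + ln y)], hence at most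
   [7 + 2 * ln y], where [y = r / eps]. As [ln y >= ln x0 > 0], the 7 is absorbed by
   [7 / ln x0 * ln y]. *)
exists (2 + 7 / ln x0) => E k r F f eps ord sel _ matF loopF rkF fsub f0 eps01.
move=> ordE selP.
pose y := r%:R / eps; pose x := ln (2 * y) / eps.
(* One successor rounds [x] up, the other is the extra pass of [run_halted]. *)
have halt : dt_halted F r f eps (dt_run F r f eps ord sel (Num.trunc x).+2).
  by apply: run_halted => // _; apply: ltW; exact: truncnS_gt.
exists (Num.trunc x).+2; split=> //.
- exact: run_supp.
- by move=> fmon; exact: run_approx_monotone.
- by move=> _ k2; exact: run_approx_nonmonotone.
move=> EO IO EO0 IO0 x0_le.
have work := run_work r F f sel eps01 ordE (Num.trunc x).+2 EO0 IO0.
apply: (le_trans work).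
have [eps_gt0 eps_lt1] := andP eps01.
rewrite -/y in x0_le *.
have y1 : 1 < y := lt_le_trans hx0 x0_le.
have y0 : 0 < y := lt_trans ltr01 y1.
have L_ge : ln x0 <= ln y by rewrite ler_ln ?posrE // (lt_trans ltr01).
have ln2 : ln (2 : R) <= 1.
  by have := @le_ln1Dx R 1; rewrite -natr1; apply; lra.
have lnM2 : ln (2 * y) = ln 2 + ln y by rewrite lnM ?posrE.
have L_gt0 : 0 < ln y := lt_le_trans lx0 L_ge.
have ln2_ge0 : 0 <= ln (2 : R) by rewrite ln_ge0 // ler1n.
have x_ge0 : 0 <= x by rewrite /x lnM2 divr_ge0 ?addr_ge0 // ltW.
have tr_le : (Num.trunc x)%:R <= x by rewrite truncn_le.
set W := #|E|%:R * (k%:R * EO + IO).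
have W0 : 0 <= W by rewrite mulr_ge0 // addr_ge0 // mulr_ge0.
have -> : (2 + 7 / ln x0) * (W / eps * ln y) =
    W * ((2 + 7 / ln x0) * ln y / eps) by ring.
apply: ler_wpM2l => //; rewrite ler_pdivlMr //.
have le7 : 7 <= 7 / ln x0 * ln y.
  by rewrite mulrAC ler_pdivlMr // ler_pM2l.
have xeps : x * eps = ln 2 + ln y by rewrite /x lnM2 divfK // gt_eqF.
have tr_eps : (Num.trunc x)%:R * eps <= x * eps by rewrite ler_pM2r.
rewrite -!natr1; move: tr_eps; rewrite xeps; lra.
Qed.
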